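(* Let $n=3$ and $p=q=2$. Let $\mu\in\mathbb{R}^4$, let $\Gamma,\Psi\in\mathcal{M}_{2,2}(\mathbb{R})$ be arbitrary symmetric positive definite matrices, and let $X_1,X_2,X_3$ be independent random matrices in $\mathcal{M}_{2,2}(\mathbb{R})$ with $\mathrm{vec}(X_k)\sim\mathcal{N}(\mu,\Psi\otimes\Gamma)$, $k=1,2,3$. Then the probability that the maximum likelihood estimator of $\Psi\otimes\Gamma$ is not unique (that is, that the global maximum of the likelihood function is attained at more than one positive definite Kronecker product) is strictly positive.
   Context: $\mathcal{M}_{p,q}(\mathbb{R})$ is the set of real $p\times q$ matrices, $\mathrm{vec}$ stacks the columns of a matrix into one vector, and $\otimes$ is the Kronecker product. The likelihood function, for $M\in\mathcal{M}_{p,q}(\mathbb{R})$ (with $\mathrm{vec}(M)$ the mean vector) and symmetric positive definite $\Gamma\in\mathcal{M}_{p,p}(\mathbb{R})$, $\Psi\in\mathcal{M}_{q,q}(\mathbb{R})$, is $$L(M,\Gamma,\Psi)=(2\pi)^{-\frac12 pqn}|\Gamma|^{-\frac12 qn}|\Psi|^{-\frac12 pn}\exp\Big(-\tfrac12\,\mathrm{trace}\Big(\Psi^{-1}\sum_{k=1}^n (X_k-M)^T\Gamma^{-1}(X_k-M)\Big)\Big),$$ where $|A|$ is the determinant of $A$. It depends on $(\Gamma,\Psi)$ only through $\Psi\otimes\Gamma$. A maximum likelihood estimator of $\Psi\otimes\Gamma$ is a matrix $\hat\Psi\otimes\hat\Gamma$ with $\hat\Gamma,\hat\Psi$ symmetric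 positive definite such that $L$ attains its global maximum, over all $M\in\mathcal{M}_{p,q}(\mathbb{R})$ and all symmetric positive definite $\Gamma,\Psi$, at $(\hat M,\hat\Gamma,\hat\Psi)$, where $\hat M=\frac1n\sum_{k=1}^n X_k$. Uniqueness concerns the Kronecker product $\hat\Psi\otimes\hat\Gamma$, not the two factors separately. *)

(* Defs.v *)
From HB Require Import structures.
From mathcomp Require Import all_boot all_order all_algebra.
From mathcomp Require Export mxtens.
From mathcomp Require Import all_classical all_reals all_analysis.

Set Implicit Arguments.
Unset Strict Implicit.
Unset Printing Implicit Defensive.

Import Order.TTheory GRing.Theory Num.Theory.
Import numFieldNormedType.Exports.

Local Open Scope classical_set_scope.
Local Open Scope ring_scope.

(* The measurable sets of matrices are the Borel sets of the usual topology of
   R^(m x n). *)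
Section borel_matrix.
Variables (R : realType) (m n : nat).

Definition borel_matrix : set (set 'M[R]_(m, n)) := <<s @open 'M[R]_(m, n) >>.

Let borel_matrix0 : borel_matrix set0.
Proof. exact: sigma_algebra0. Qed.

Let borel_matrixC (A : set 'M[R]_(m, n)) :
  borel_matrix A -> borel_matrix (~` A).
Proof. by move=> mA; rewrite -setTD; exact: sigma_algebraCD. Qed.

Let borel_matrix_bigcup (F : (set 'M[R]_(m, n))^nat) :
  (forall i, borel_matrix (F i)) -> borel_matrix (\bigcup_i F i).
Proof. exact: sigma_algebra_bigcup. Qed.

HB.instance Definition _ := @isMeasurable.Build default_measure_display
  'M[R]_(m, n) borel_matrix borel_matrix0 borel_matrixC borel_matrix_bigcup.

End borel_matrix.

Section matrix_normal.
Variable R : realType.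

(* Index j * p + i of [vec M] holds [M i j]: with this order the covariance of
   the vectorised matrix is [Psi *t Gamma]. *)
Definition vec (p q : nat) (M : 'M[R]_(p, q)) : 'cV[R]_(q * p) :=
  \col_k M (mxtens_unindex k).2 (mxtens_unindex k).1.

Lemma vecE (p q : nat) (M : 'M[R]_(p, q)) (i : 'I_p) (j : 'I_q) (k : 'I_1) :
  vec M (mxtens_index (j, i)) k = M i j.
Proof. by rewrite mxE mxtens_indexK. Qed.

Definition sym_posdef (m : nat) (A : 'M[R]_m) : Prop :=
  A^T = A /\ (forall v : 'cV[R]_m, v != 0 -> 0 < (v^T *m A *m v) 0 0).

(* Integral over R^m with respect to Lebesgue measure, as an iterated integral;
   for nonnegative Borel functions the two agree by Tonelli's theorem. *)
Fixpoint lebesgue_integral_cV (m : nat) : ('cV[R]_m -> \bar R) -> \bar R :=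
  match m with
  | 0 => fun f => f 0
  | m'.+1 => fun f => (\int[lebesgue_measure]_x
      lebesgue_integral_cV (fun v : 'cV[R]_m' => f (col_mx x%:M v)))%E
  end.

Definition mvnormal_pdf (m : nat) (mu : 'cV[R]_m) (Sigma : 'M[R]_m)
    (x : 'cV[R]_m) : R :=
  (Num.sqrt ((2 * pi) ^+ m * \det Sigma))^-1 *
  expR (- ((x - mu)^T *m invmx Sigma *m (x - mu)) 0 0 / 2).

(* Only meaningful for a positive definite Sigma: a singular normal law has no
   density. *)
Definition has_mvnormal_law d (Omega : measurableType d)
    (P : probability Omega R) (m : nat) (Y : Omega -> 'cV[R]_m)
    (mu : 'cV[R]_m) (Sigma : 'M[R]_m) : Prop :=
  forall B : set 'cV[R]_m, measurable B ->
    P (Y @^-1` B) =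
    lebesgue_integral_cV (fun x => (mvnormal_pdf mu Sigma x * \1_B x)%:E).

Definition mutually_independent d (Omega : measurableType d)
    (P : probability Omega R) d' (T : measurableType d') (n : nat)
    (X : 'I_n -> Omega -> T) : Prop :=
  forall (J : {set 'I_n}) (B : 'I_n -> set T),
    (forall k, measurable (B k)) ->
    P (\bigcap_(k in [set` J]) X k @^-1` B k) =
    (\prod_(k in J) P (X k @^-1` B k))%E.

Definition likelihood (n p q : nat) (X : 'I_n -> 'M[R]_(p, q))
    (M : 'M[R]_(p, q)) (Gamma : 'M[R]_p) (Psi : 'M[R]_q) : R :=
  (2 * pi) `^ (- (2^-1 * (p * q * n)%:R)) *
  \det Gamma `^ (- (2^-1 * (q * n)%:R)) *
  \det Psi `^ (- (2^-1 * (p * n)%:R)) *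
  expR (- (2^-1 * \tr (invmx Psi *m
    \sum_(k < n) ((X k - M)^T *m invmx Gamma *m (X k - M))))).

Definition sample_mean (n p q : nat) (X : 'I_n -> 'M[R]_(p, q)) :
  'M[R]_(p, q) := n%:R^-1 *: \sum_(k < n) X k.

Definition is_mle (n p q : nat) (X : 'I_n -> 'M[R]_(p, q))
    (K : 'M[R]_(q * p)) : Prop :=
  exists (hGamma : 'M[R]_p) (hPsi : 'M[R]_q),
    [/\ sym_posdef hGamma, sym_posdef hPsi, K = hPsi *t hGamma &
      forall (M : 'M[R]_(p, q)) (Gamma : 'M[R]_p) (Psi : 'M[R]_q),
        sym_posdef Gamma -> sym_posdef Psi ->
        likelihood X M Gamma Psi <= likelihood X (sample_mean X) hGamma hPsi].

Definition mle_not_unique (n p q : nat) (X : 'I_n -> 'M[R]_(p, q)) : Prop :=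
  exists K1 K2 : 'M[R]_(q * p), [/\ is_mle X K1, is_mle X K2 & K1 <> K2].

End matrix_normal.

(* Main.v *)
Require Import Defs.
From mathcomp Require Import all_boot all_order all_algebra.
From mathcomp Require Import all_classical all_reals all_analysis.
From mathcomp Require Import measurable_realfun ring lra.

Set Implicit Arguments.
Unset Strict Implicit.
Unset Printing Implicit Defensive.

Import Order.TTheory GRing.Theory Num.Theory.
Import numFieldNormedType.Exports.

Local Open Scope classical_set_scope.
Local Open Scope ring_scope.

(** In terms of the precision matrices A = Gamma^-1 and B = Psi^-1, the
    likelihood at the sample mean is a constant times
    (det A det B)^3 exp (- tr (B C(A)) / 2), where
    C(A) = sum_k (X_k - mean)^T A (X_k - mean).
    For fixed A it is bounded in B iff det C(A) > 0, and then the only maximiser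
    is B = 6 C(A)^-1, so that one is left with minimising det C(A) / det A.
    The quadratic form A |-> det C(A) on symmetric matrices satisfies
      det C(A) = gap * det A + k(A)^2 / 12
    for a constant gap >= 0 and a linear form k (evaluate both sides on the null
    cone of det). If gap > 0 and k vanishes at a point of the positive definite
    cone, it vanishes on more than one ray; all these zeros are minimisers and
    different rays give different Kronecker products. If k has no zero there,
    k^2 / det has at most one minimising ray. Hence non-uniqueness is the Borel
    condition: gap > 0, and k has positive discriminant or is zero. It holds on
    a product of three open boxes, which has positive probability. *)

(** * Two-by-two positive definite matrices *)

Lemma sum_ord2 (V : nmodType) (F : 'I_2 -> V) : \sum_i F i = F 0 + F 1.
Proof.
by rewrite !big_ord_recl big_ord0 addr0; congr (F _ + F _); exact: val_inj.
Qed.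

Lemma ord2P (T : Prop) (i : 'I_2) : (i = 0 -> T) -> (i = 1 -> T) -> T.
Proof.
case: i => [[|[|//]] lti] H0 H1; [apply: H0|apply: H1]; exact: val_inj.
Qed.

Lemma matrix2P (T : Type) (A B : 'M[T]_2) :
  A 0 0 = B 0 0 -> A 0 1 = B 0 1 -> A 1 0 = B 1 0 -> A 1 1 = B 1 1 -> A = B.
Proof.
move=> e00 e01 e10 e11; apply/matrixP => i j.
by apply: (ord2P (i := i)) => ->; apply: (ord2P (i := j)) => ->.
Qed.

Section matrix2.
Variable F : fieldType.
Implicit Types A B C : 'M[F]_2.

Lemma det2E A : \det A = A 0 0 * A 1 1 - A 0 1 * A 1 0.
Proof.
rewrite (expand_det_row _ 0) sum_ord2 /cofactor !det_mx11 !mxE /=.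
rewrite expr0 expr1 mul1r mulN1r mulrN.
by congr (_ * A _ _ - _ * A _ _); exact: val_inj.
Qed.

Definition mx2 (a b c d : F) : 'M[F]_2 :=
  \matrix_(i, j) if i == 0 then (if j == 0 then a else b)
                 else (if j == 0 then c else d).

Lemma mx2E a b c d :
  ((mx2 a b c d 0 0 = a) * (mx2 a b c d 0 1 = b)) *
  ((mx2 a b c d 1 0 = c) * (mx2 a b c d 1 1 = d)).
Proof. by rewrite !mxE. Qed.

Lemma invmx2E A : \det A != 0 ->
  invmx A = (\det A)^-1 *: mx2 (A 1 1) (- A 0 1) (- A 1 0) (A 0 0).
Proof.
move=> dA; have uA : A \in unitmx by rewrite unitmxE unitfE.
apply: (can_inj (mulKmx uA)); rewrite mulmxV// -scalemxAr.
apply: matrix2P; rewrite !mxE ?sum_ord2 !mx2E /= ?mulr1n ?mulr0n;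
  rewrite det2E in dA *; field; exact: dA.
Qed.

Lemma invmx2Z A (c : F) : c != 0 -> \det A != 0 ->
  invmx (c *: A) = c^-1 *: invmx A.
Proof.
by move=> c0 dA; rewrite invmxZ// unitmxE unitfE detZ mulf_eq0 expf_eq0 /= (negPf c0).
Qed.

Lemma trace_mulmx2 B C : \tr (B *m C) =
  B 0 0 * C 0 0 + B 0 1 * C 1 0 + B 1 0 * C 0 1 + B 1 1 * C 1 1.
Proof. by rewrite /mxtrace sum_ord2 !mxE !sum_ord2 !addrA. Qed.

End matrix2.

Section posdef2.
Variable R : realType.
Implicit Types A B C : 'M[R]_2.

Definition sym_psd (m : nat) (A : 'M[R]_m) : Prop :=
  A^T = A /\ (forall v : 'cV[R]_m, 0 <= (v^T *m A *m v) 0 0).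

Lemma sym_posdef_psd (m : nat) (A : 'M[R]_m) : sym_posdef A -> sym_psd A.
Proof.
case=> sA pA; split=> // v; have [->|/pA/ltW//] := eqVneq v 0.
by rewrite mulmx0 mxE.
Qed.

Lemma sym_psd_conj (m l : nat) (A : 'M[R]_m) (N : 'M[R]_(m, l)) :
  sym_psd A -> sym_psd (N^T *m A *m N).
Proof.
case=> sA pA; split; first by rewrite !trmx_mul trmxK sA mulmxA.
by move=> v; have := pA (N *m v); rewrite trmx_mul !mulmxA.
Qed.

Lemma sym_psdD (m : nat) (A B : 'M[R]_m) :
  sym_psd A -> sym_psd B -> sym_psd (A + B).
Proof.
move=> [sA pA] [sB pB]; split; first by rewrite linearD /= sA sB.
by move=> v; rewrite mulmxDr mulmxDl mxE addr_ge0.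
Qed.

Lemma sym_psd0 (m : nat) : sym_psd (0 : 'M[R]_m).
Proof. by split=> [|v]; rewrite ?trmx0// mulmx0 mul0mx mxE. Qed.

Lemma sym_psd_sum (I : finType) (m : nat) (A : I -> 'M[R]_m) :
  (forall i, sym_psd (A i)) -> sym_psd (\sum_i A i).
Proof.
move=> pA; apply: (big_ind (@sym_psd m)) => //; first exact: sym_psd0.
exact: sym_psdD.
Qed.

Lemma quad_form2 A (v : 'cV[R]_2) : (v^T *m A *m v) 0 0 =
  A 0 0 * v 0 0 ^+ 2 + (A 0 1 + A 1 0) * v 0 0 * v 1 0 + A 1 1 * v 1 0 ^+ 2.
Proof.
by rewrite !mxE !sum_ord2 !mxE !sum_ord2 !mxE; ring.
Qed.

Lemma sym2 A : A^T = A -> A 1 0 = A 0 1.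
Proof. by move=> {2}<-; rewrite mxE. Qed.

(** Sylvester's criterion: one direction tests the form on two vectors, the other multiplies it by
    [A 0 0] and completes the square. *)
Lemma sym_posdef2P A :
  sym_posdef A <-> [/\ A 1 0 = A 0 1, 0 < A 0 0 & 0 < \det A].
Proof.
split=> [[sA pA]|[sA A0 dA]].
  have s10 := sym2 sA.
  have A0 : 0 < A 0 0.
    have := pA (\col_i (i == 0)%:R); rewrite quad_form2 !mxE /=.
    rewrite expr1n expr0n /= !mulr0 !addr0 mulr1; apply.
    by apply/eqP => /matrixP/(_ 0 0); rewrite !mxE /= => /eqP; rewrite oner_eq0.
  (* At the vector with entries [- A 0 1] and [A 0 0] the form takes the value [A 0 0 * \det A]. *)
  split=> //; have := pA (\col_i if i == 0 then - A 0 1 else A 0 0).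
  rewrite quad_form2 !mxE /= => H.
  rewrite -(pmulr_rgt0 _ A0).
  have -> : A 0 0 * \det A = A 0 0 * (- A 0 1) ^+ 2 +
      (A 0 1 + A 1 0) * - A 0 1 * A 0 0 + A 1 1 * A 0 0 ^+ 2.
    by rewrite det2E s10; ring.
  apply: H; apply/eqP => /matrixP/(_ 1 0); rewrite !mxE /= => A00.
  by rewrite A00 ltxx in A0.
split.
  by apply: matrix2P; rewrite !mxE.
move=> v v0; rewrite -(pmulr_rgt0 _ A0) quad_form2 sA.
have -> : A 0 0 * (A 0 0 * v 0 0 ^+ 2 + (A 0 1 + A 0 1) * v 0 0 * v 1 0 +
    A 1 1 * v 1 0 ^+ 2) =
  (A 0 0 * v 0 0 + A 0 1 * v 1 0) ^+ 2 + \det A * v 1 0 ^+ 2.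
  by rewrite det2E sA; ring.
have [v1|v1] := eqVneq (v 1 0) 0; last first.
  by rewrite ltr_wpDl ?sqr_ge0// mulr_gt0// exprn_even_gt0.
rewrite v1 mulr0 addr0 expr0n /= mulr0 addr0 exprn_even_gt0//= mulf_neq0//.
  by rewrite gt_eqF.
apply: contra v0 => /eqP v00; apply/eqP/matrixP => i j.
by rewrite !mxE ord1; apply: (ord2P (i := i)) => ->.
Qed.

Lemma det_posdef2_gt0 A : sym_posdef A -> 0 < \det A.
Proof. by case/sym_posdef2P. Qed.

Lemma sym_posdef2_inv A : sym_posdef A -> sym_posdef (invmx A).
Proof.
move=> pA; have /sym_posdef2P[sA A0 dA] := pA.
have d0 : \det A != 0 by rewrite gt_eqF.
apply/sym_posdef2P; split.
- by rewrite invmx2E// !mxE /= sA.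
- rewrite invmx2E// !mxE /= mulr_gt0 ?invr_gt0// -(pmulr_rgt0 _ A0).
  move: dA; rewrite det2E sA subr_gt0; apply: le_lt_trans.
  by rewrite -expr2 sqr_ge0.
- by rewrite det_inv invr_gt0.
Qed.

Lemma sym_posdef2Z A (c : R) : 0 < c -> sym_posdef A -> sym_posdef (c *: A).
Proof.
move=> c0 /sym_posdef2P[sA A0 dA]; apply/sym_posdef2P; split.
- by rewrite !mxE sA.
- by rewrite mxE mulr_gt0.
- by rewrite detZ mulr_gt0// exprn_gt0.
Qed.

Lemma sym_psd2_posdef C : sym_psd C -> 0 < \det C -> sym_posdef C.
Proof.
move=> [sC pC] dC; apply/sym_posdef2P; split => //; first exact: sym2.
have := pC (\col_i (i == 0)%:R); rewrite quad_form2 !mxE /=.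
rewrite expr1n expr0n /= !mulr0 !addr0 mulr1 le_eqVlt => /orP[/eqP C0|//].
move: dC; rewrite det2E -C0 mul0r (sym2 sC) sub0r oppr_gt0 -expr2.
by rewrite ltNge sqr_ge0.
Qed.

Lemma sym_psd2_diag C : sym_psd C -> 0 <= C 0 0 /\ 0 <= C 1 1.
Proof.
move=> [sC pC]; split.
  have := pC (\col_i (i == 0)%:R); rewrite quad_form2 !mxE /=.
  by rewrite expr1n expr0n /= !mulr0 !addr0 mulr1.
have := pC (\col_i (i == 1)%:R); rewrite quad_form2 !mxE /=.
by rewrite expr1n expr0n /= !mulr0 mul0r !add0r mulr1.
Qed.

(** [B 0 0] times the trace is the form [C] evaluated at the first row of [B], plus
    [\det B * C 1 1]; both terms are nonnegative. *)
Lemma trace_posdef_psd_ge0 B C : sym_posdef B -> sym_psd C -> 0 <= \tr (B *m C).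
Proof.
move=> /sym_posdef2P[sB B0 dB] pC; rewrite -(pmulr_rge0 _ B0).
have [_ C1] := sym_psd2_diag pC; case: pC => sC pC.
have := pC (\col_i B 0 i); rewrite quad_form2 !mxE /= => pBC.
have -> : B 0 0 * \tr (B *m C) =
  (C 0 0 * B 0 0 ^+ 2 + (C 0 1 + C 1 0) * B 0 0 * B 0 1 + C 1 1 * B 0 1 ^+ 2) +
   \det B * C 1 1.
  by rewrite trace_mulmx2 det2E sB; ring.
by rewrite addr_ge0// mulr_ge0// ltW.
Qed.

(** The discriminant of the characteristic polynomial of [B *m C], scaled by [B 0 0 ^+ 2] so that it
    becomes an explicit sum of squares when [\det B > 0]. Its sign is the AM-GM bound of determinant
    by trace, and its vanishing is the equality case. *)
Lemma trace_sqr_sub_det B C : B 1 0 = B 0 1 -> C 1 0 = C 0 1 ->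
  B 0 0 ^+ 2 * (\tr (B *m C) ^+ 2 - 4 * (\det B * \det C)) =
  (B 0 0 ^+ 2 * C 0 0 + 2 * B 0 0 * B 0 1 * C 0 1 + B 0 1 ^+ 2 * C 1 1 -
    \det B * C 1 1) ^+ 2 +
  4 * \det B * (B 0 0 * C 0 1 + B 0 1 * C 1 1) ^+ 2.
Proof. by move=> sB sC; rewrite trace_mulmx2 !det2E sB sC; ring. Qed.

Lemma det_le_trace_sqr B C : sym_posdef B -> C^T = C ->
  4 * (\det B * \det C) <= \tr (B *m C) ^+ 2.
Proof.
move=> /sym_posdef2P[sB B0 dB] /sym2 sC.
rewrite -subr_ge0 -(pmulr_rge0 _ (exprn_gt0 2 B0)) trace_sqr_sub_det//.
by rewrite addr_ge0 ?sqr_ge0// mulr_ge0 ?sqr_ge0// mulr_ge0// ltW.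
Qed.

(** In the equality case both squares vanish, and these two linear equations determine [C] from
    [C 1 1]; the solutions are the multiples of [invmx B]. *)
Lemma det_trace_sqr_eq B C : sym_posdef B -> C^T = C ->
  \tr (B *m C) ^+ 2 <= 4 * (\det B * \det C) ->
  C = (\tr (B *m C) / 2) *: invmx B.
Proof.
move=> /sym_posdef2P[sB B0 dB] /sym2 sC.
rewrite -subr_le0 -(pmulr_rle0 _ (exprn_gt0 2 B0)) trace_sqr_sub_det//.
set x := (X in X ^+ 2 + _); set y := (X in _ * X ^+ 2) => le0.
have y0 : 0 <= 4 * \det B * y ^+ 2.
  by rewrite mulr_ge0 ?sqr_ge0// mulr_ge0// ltW.
have x0 : x = 0.
  apply/eqP; rewrite -sqrf_eq0 eq_le sqr_ge0 andbT.
  by apply: le_trans le0; rewrite lerDl.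
have {}y0 : y = 0.
  apply/eqP; rewrite -sqrf_eq0 eq_le sqr_ge0 andbT.
  have : 4 * \det B * y ^+ 2 <= 0 by move: le0; rewrite x0 expr0n add0r.
  by rewrite pmulr_rle0// mulr_gt0.
have B0' : B 0 0 != 0 by rewrite gt_eqF.
have d0 : B 0 0 * B 1 1 - B 0 1 * B 0 1 != 0 by rewrite -{2}sB -det2E gt_eqF.
have e01 : C 0 1 = - B 0 1 * C 1 1 / B 0 0.
  by apply: (mulfI B0'); move/eqP: y0; rewrite addr_eq0 => /eqP ->; field.
have e00 : C 0 0 = B 1 1 * C 1 1 / B 0 0.
  apply: (mulfI (expf_neq0 2 B0')).
  move: x0; rewrite /x e01 det2E sB => /eqP; rewrite subr_eq0 => /eqP.
  move=> h; transitivity (B 0 0 ^+ 2 * C 0 0 + 2 * B 0 0 * B 0 1 *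
    (- B 0 1 * C 1 1 / B 0 0) + B 0 1 ^+ 2 * C 1 1 + B 0 1 ^+2 * C 1 1).
    by field.
  by rewrite h; field.
rewrite invmx2E ?gt_eqF// trace_mulmx2 sB sC e00 e01 det2E sB.
by apply: matrix2P; rewrite !mxE /= ?sC ?e00 ?e01 ?sB; field; rewrite B0' d0.
Qed.

End posdef2.

(** * The scatter matrix of three observations *)

Section scatter.
Variable R : realType.

Definition scatter (n p q : nat) (X : 'I_n -> 'M[R]_(p, q)) (A : 'M[R]_p) :
  'M[R]_q :=
  \sum_k (X k - sample_mean X)^T *m A *m (X k - sample_mean X).

Lemma scatter_psd (n p q : nat) (X : 'I_n -> 'M[R]_(p, q)) (A : 'M[R]_p) :
  sym_psd A -> sym_psd (scatter X A).
Proof. by move=> pA; apply: sym_psd_sum => k; exact: sym_psd_conj. Qed.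

Lemma scatterZ (n p q : nat) (X : 'I_n -> 'M[R]_(p, q)) (A : 'M[R]_p) (c : R) :
  scatter X (c *: A) = c *: scatter X A.
Proof.
rewrite /scatter scaler_sumr; apply: eq_bigr => k _.
by rewrite -scalemxAr -scalemxAl.
Qed.

(** Deviations from the sample mean sum to zero, so the cross terms vanish and [M] survives in a
    single term. *)
Lemma sum_conj_sub (n p q : nat) (X : 'I_n.+1 -> 'M[R]_(p, q))
    (M : 'M[R]_(p, q)) (A : 'M[R]_p) :
  \sum_k (X k - M)^T *m A *m (X k - M) =
  scatter X A + n.+1%:R *: ((sample_mean X - M)^T *m A *m (sample_mean X - M)).
Proof.
set D := sample_mean X - M; pose Y k := X k - sample_mean X.
have sumY : \sum_k Y k = 0.
  rewrite sumrB sumr_const card_ord /sample_mean -[_ *+ n.+1]scaler_nat.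
  by rewrite scalerA mulfV ?pnatr_eq0// scale1r subrr.
transitivity (\sum_k (Y k)^T *m A *m Y k + (\sum_k Y k)^T *m A *m D +
   D^T *m A *m (\sum_k Y k) + n.+1%:R *: (D^T *m A *m D)); last first.
  by rewrite sumY trmx0 !mul0mx mulmx0 !addr0.
rewrite raddf_sum !mulmx_suml mulmx_sumr scaler_nat.
have -> : D^T *m A *m D *+ n.+1 = \sum_(k < n.+1) D^T *m A *m D.
  by rewrite sumr_const card_ord.
rewrite -!big_split /=.
apply: eq_bigr => k _.
have -> : X k - M = Y k + D by rewrite addrA subrK.
by rewrite [(Y k + D)^T]linearD /= !mulmxDl !mulmxDr !addrA.
Qed.

End scatter.

Section three_matrices.
Variables (R : realType) (X : 'I_3 -> 'M[R]_2).

Let P := X 0 - X 1.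
Let Q := X 0 + X 1 - 2 *: X (inord 2).

(** [P] and [Q] are the orthogonal contrasts (1, -1, 0) and (1, 1, -2) of the three observations; 2
    and 6 are the squared norms of these vectors. *)
Lemma scatter3E (A : 'M[R]_2) : scatter X A =
  2^-1 *: (P^T *m A *m P) + 6^-1 *: (Q^T *m A *m Q).
Proof.
have sum3 (V : nmodType) (F : 'I_3 -> V) : \sum_i F i = F 0 + F 1 + F (inord 2).
  rewrite !big_ord_recr big_ord0 /= add0r; congr (F _ + F _ + F _);
    by apply: val_inj; rewrite /= ?inordK.
rewrite /scatter sum3; set M := sample_mean X.
have -> : X (inord 2) - M = - (3^-1 *: Q).
  by apply/matrixP => i j; rewrite /M /sample_mean sum3 /Q !mxE; field.
have -> : X 0 - M = 2^-1 *: P + 6^-1 *: Q.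
  by apply/matrixP => i j; rewrite /M /sample_mean sum3 /Q !mxE; field.
have -> : X 1 - M = - 2^-1 *: P + 6^-1 *: Q.
  by apply/matrixP => i j; rewrite /M /sample_mean sum3 /Q !mxE; field.
clearbody P Q; clear M.
by apply/matrixP => i j; rewrite !(mxE, sum_ord2); field.
Qed.

(* For symmetric A, [kform A] is tr (P J Q^T A) where J = [[0, 1], [-1, 0]]. *)
Definition kform0 : R := P 0 0 * Q 0 1 - P 0 1 * Q 0 0.
Definition kform1 : R :=
  P 0 0 * Q 1 1 - P 0 1 * Q 1 0 + P 1 0 * Q 0 1 - P 1 1 * Q 0 0.
Definition kform2 : R := P 1 0 * Q 1 1 - P 1 1 * Q 1 0.

Definition kform (A : 'M[R]_2) : R :=
  kform0 * A 0 0 + kform1 * A 0 1 + kform2 * A 1 1.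

(** The coefficient of s t in the binary form det (s P + t Q). *)
Definition mixed_det : R :=
  P 0 0 * Q 1 1 + P 1 1 * Q 0 0 - P 0 1 * Q 1 0 - P 1 0 * Q 0 1.

(** This is the squared modulus of det (P / sqrt 2 + i Q / sqrt 6). *)
Definition scatter_gap : R :=
  (\det P / 2 - \det Q / 6) ^+ 2 + mixed_det ^+ 2 / 12.

(** For A = v v^T the scatter matrix is a a^T / 2 + b b^T / 6 with a = P^T v and b = Q^T v. Its
    determinant is (a0 b1 - a1 b0)^2 / 12, and a0 b1 - a1 b0 is [kform A]. *)
Lemma det_scatter3 (A : 'M[R]_2) : A 1 0 = A 0 1 ->
  \det (scatter X A) = scatter_gap * \det A + kform A ^+ 2 / 12.
Proof.
move=> sA; rewrite scatter3E /scatter_gap /kform /mixed_det /kform0 /kform1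
  /kform2 !det2E.
clearbody P Q.
by rewrite !(mxE, sum_ord2) sA; field.
Qed.

(** The right-hand side is the discriminant of det (s P + t Q), hence positive as soon as det P and
    det Q have opposite signs. *)
Lemma kform_disc : kform1 ^+ 2 - 4 * (kform0 * kform2) =
  mixed_det ^+ 2 - 4 * (\det P * \det Q).
Proof.
rewrite /mixed_det /kform0 /kform1 /kform2 !det2E.
by clearbody P Q; ring.
Qed.

Lemma kformZ c A : kform (c *: A) = c * kform A.
Proof. by rewrite /kform !mxE; ring. Qed.

Lemma kformD A B : kform (A + B) = kform A + kform B.
Proof. by rewrite /kform !mxE; ring. Qed.

End three_matrices.

(** * The likelihood in terms of precision matrices *)

Section pow_exp.
Variable R : realType.
Implicit Types t : R.

Let div_le_expR n t : t / n.+1%:R <= expR (t / n.+1%:R - 1).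
Proof. by have := expR_ge1Dx (t / n.+1%:R - 1); rewrite addrC subrK. Qed.

Let pow_expR n t : expR (t / n.+1%:R - 1) ^+ n.+1 = expR t * expR (- n.+1%:R).
Proof.
rewrite -expRM_natl mulrBr mulr1 mulrCA mulfV ?pnatr_eq0// mulr1.
by rewrite expRD.
Qed.

(** The tangent bound x <= exp (x - 1) at x = t / (n + 1), raised to the power n + 1. *)
Lemma pow_expRN_le n t : 0 <= t ->
  t ^+ n.+1 * expR (- t) <= n.+1%:R ^+ n.+1 * expR (- n.+1%:R).
Proof.
move=> t0; rewrite expRN ler_pdivrMr ?expR_gt0// -mulrA [expR _ * _]mulrC.
rewrite -pow_expR -ler_pdivrMl ?exprn_gt0// -exprVn -exprMn [_^-1 * _]mulrC.
by rewrite lerXn2r ?nnegrE ?divr_ge0// ?expR_ge0.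
Qed.

(** The tangent bound is strict except at x = 1, so the maximum has only one maximiser. *)
Lemma pow_expRN_eq n t : 0 <= t ->
  n.+1%:R ^+ n.+1 * expR (- n.+1%:R) <= t ^+ n.+1 * expR (- t) -> t = n.+1%:R.
Proof.
move=> t0; rewrite [X in _ <= X]mulrC expRN -ler_pdivrMl ?invr_gt0 ?expR_gt0//.
rewrite invrK mulrCA -pow_expR -ler_pdivlMl ?exprn_gt0// -exprVn -exprMn.
rewrite [_^-1 * _]mulrC ler_pXn2r ?nnegrE ?divr_ge0// ?expR_ge0// => le_t.
have [/eqP|/expR_gt1Dx] := eqVneq (t / n.+1%:R - 1) 0.
  by rewrite subr_eq0 => /eqP/divr1_eq.
by rewrite addrC subrK ltNge le_t.
Qed.

End pow_exp.

Section concentrated_likelihood.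
Variables (R : realType) (X : 'I_3 -> 'M[R]_2).
Implicit Types A B : 'M[R]_2.

(* The likelihood at the sample mean without its constant factor; A and B stand
   for the inverses of Gamma and Psi. *)
Definition conc_lik A B : R :=
  (\det A * \det B) ^+ 3 * expR (- (2^-1 * \tr (B *m scatter X A))).

(** The last factor carries all dependence on [M]; it is at most 1, with value 1 at the sample
    mean. *)
Lemma likelihood_conc (M Gamma Psi : 'M[R]_2) :
  sym_posdef Gamma -> sym_posdef Psi ->
  likelihood X M Gamma Psi =
  (2 * pi) `^ (- (2^-1 * (2 * 2 * 3)%:R)) *
  (conc_lik (invmx Gamma) (invmx Psi) *
   expR (- (2^-1 * (3 * \tr (invmx Psi *m ((sample_mean X - M)^T *m
     invmx Gamma *m (sample_mean X - M))))))).
Proof.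
move=> pG pP; rewrite /likelihood -(mulrA (_ * _)) -mulrA; congr (_ * _).
(* The exponents q n / 2 and p n / 2 both equal 3, so the real powers are cubes of the determinants
   of the inverses. *)
have powd (S : 'M[R]_2) : sym_posdef S ->
    \det S `^ (- (2^-1 * (2 * 3)%:R)) = \det (invmx S) ^+ 3.
  move=> /det_posdef2_gt0 d0; rewrite natrM mulrA mulVf ?pnatr_eq0// mul1r.
  by rewrite powRN powR_mulrn ?ltW// det_inv exprVn.
rewrite !powd// /conc_lik exprMn [in LHS]mulrA -[in RHS]mulrA; congr (_ * _).
rewrite -expRD; congr expR.
rewrite sum_conj_sub mulmxDr raddfD /= -scalemxAr mxtraceZ.
by rewrite mulrDr opprD.
Qed.

Lemma is_mle_conc (K : 'M[R]_(2 * 2)) : is_mle X K <->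
  exists A B, [/\ sym_posdef A, sym_posdef B, K = invmx B *t invmx A &
    forall A' B', sym_posdef A' -> sym_posdef B' ->
      conc_lik A' B' <= conc_lik A B].
Proof.
have c0 : 0 < (2 * pi : R) `^ (- (2^-1 * (2 * 2 * 3)%:R)).
  by rewrite powR_gt0// mulr_gt0// pi_gt0.
have at_mean (Gamma Psi : 'M[R]_2) : sym_posdef Gamma -> sym_posdef Psi ->
    likelihood X (sample_mean X) Gamma Psi =
    (2 * pi) `^ (- (2^-1 * (2 * 2 * 3)%:R)) *
    conc_lik (invmx Gamma) (invmx Psi).
  move=> pG pP; rewrite likelihood_conc// subrr trmx0 !mul0mx mulmx0 mxtrace0.
  by rewrite !mulr0 oppr0 expR0 mulr1.
split=> [[G [S [pG pS -> max]]]|[A [B [pA pB -> max]]]].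
  exists (invmx G), (invmx S); rewrite !invmxK; split=> //.
  - exact: sym_posdef2_inv.
  - exact: sym_posdef2_inv.
  move=> A' B' pA' pB'.
  have := max (sample_mean X) _ _ (sym_posdef2_inv pA') (sym_posdef2_inv pB').
  rewrite !at_mean//; [|exact: sym_posdef2_inv..].
  by rewrite !invmxK ler_pM2l.
exists (invmx A), (invmx B); split=> //; [exact: sym_posdef2_inv..|].
move=> M G S pG pS; rewrite at_mean; [|exact: sym_posdef2_inv..].
rewrite likelihood_conc// ler_pM2l// !invmxK.
apply: le_trans (max _ _ (sym_posdef2_inv pG) (sym_posdef2_inv pS)).
have dG := ltW (det_posdef2_gt0 (sym_posdef2_inv pG)).
have dS := ltW (det_posdef2_gt0 (sym_posdef2_inv pS)).
rewrite ler_piMr ?mulr_ge0 ?expR_ge0 ?exprn_ge0 ?mulr_ge0//.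
rewrite -expR0 ler_expR oppr_le0 !mulr_ge0//.
apply: trace_posdef_psd_ge0; first exact: sym_posdef2_inv.
exact/sym_psd_conj/sym_posdef_psd/sym_posdef2_inv.
Qed.

(** The maximum over s >= 0 of s^6 exp (- s), attained at s = 6; s will be half the trace of
    [B *m scatter X A]. *)
Let max6 : R := 6 ^+ 6 * expR (- 6).

Let half_trace_ge0 A B : sym_posdef A -> sym_posdef B ->
  0 <= 2^-1 * \tr (B *m scatter X A).
Proof.
move=> pA pB; rewrite mulr_ge0//; apply: trace_posdef_psd_ge0 => //.
exact/scatter_psd/sym_posdef_psd.
Qed.

Lemma det_scatter_ge0 A : sym_posdef A -> 0 <= \det (scatter X A).
Proof.
move=> pA; have /sym_posdef2P[sA _ dA] := pA; rewrite det_scatter3//.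
have sqr_div_ge0 (x : R) : 0 <= x ^+ 2 / 12 by rewrite divr_ge0 ?sqr_ge0.
by rewrite addr_ge0// mulr_ge0 ?addr_ge0 ?sqr_ge0// ltW.
Qed.

Let det_le_half_trace A B : sym_posdef A -> sym_posdef B ->
  \det B * \det (scatter X A) <= (2^-1 * \tr (B *m scatter X A)) ^+ 2.
Proof.
move=> pA pB.
have := det_le_trace_sqr pB (scatter_psd X (sym_posdef_psd pA)).1.
set t := \tr _; rewrite (_ : (2^-1 * t) ^+ 2 = t ^+ 2 / 4); last by field.
by rewrite ler_pdivlMr// mulrC.
Qed.

Let conc_lik_mulE A B : conc_lik A B * \det (scatter X A) ^+ 3 =
  (\det B * \det (scatter X A)) ^+ 3 *
  expR (- (2^-1 * \tr (B *m scatter X A))) * \det A ^+ 3.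
Proof. by rewrite /conc_lik; ring. Qed.

(** With s half the trace, AM-GM bounds [\det B * \det (scatter X A)] by s^2, and s^6 exp (- s) is
    at most [max6]. The factor [\det (scatter X A) ^+ 3] is kept on the left because it may be
    zero. *)
Lemma conc_lik_le A B : sym_posdef A -> sym_posdef B ->
  conc_lik A B * \det (scatter X A) ^+ 3 <= max6 * \det A ^+ 3.
Proof.
move=> pA pB; have T0 := half_trace_ge0 pA pB.
rewrite conc_lik_mulE ler_pM2r ?exprn_gt0 ?det_posdef2_gt0//.
apply: le_trans (pow_expRN_le 5 T0).
rewrite ler_pM2r ?expR_gt0// (exprM _ 2 3) lerXn2r ?nnegrE ?sqr_ge0//.
  by rewrite mulr_ge0 ?det_scatter_ge0// ltW// det_posdef2_gt0.
exact: det_le_half_trace.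
Qed.

(** Both inequalities must be equalities: the scalar one fixes s = 6, then AM-GM makes the scatter
    matrix a multiple of [invmx B]. *)
Lemma conc_lik_eq A B : sym_posdef A -> sym_posdef B ->
  max6 * \det A ^+ 3 <= conc_lik A B * \det (scatter X A) ^+ 3 ->
  scatter X A = 6 *: invmx B.
Proof.
move=> pA pB; have T0 := half_trace_ge0 pA pB.
rewrite conc_lik_mulE ler_pM2r ?exprn_gt0 ?det_posdef2_gt0// => le_max.
have y0 : 0 <= \det B * \det (scatter X A).
  by rewrite mulr_ge0 ?det_scatter_ge0// ltW// det_posdef2_gt0.
have le_T := det_le_half_trace pA pB.
have T6 : 2^-1 * \tr (B *m scatter X A) = 6.
  apply: (pow_expRN_eq (n := 5) T0); apply: le_trans le_max _.
  rewrite ler_pM2r ?expR_gt0// (exprM _ 2 3).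
  by rewrite lerXn2r ?nnegrE ?sqr_ge0.
move: le_max; rewrite T6 /max6 ler_pM2r ?expR_gt0// (exprM _ 2 3).
rewrite ler_pXn2r ?nnegrE ?sqr_ge0// => le_y.
rewrite {1}(@det_trace_sqr_eq _ B (scatter X A))//.
- by congr (_ *: _); rewrite mulrC.
- by case: (scatter_psd X (sym_posdef_psd pA)).
- have -> : \tr (B *m scatter X A) = 2 * 6 by rewrite -T6; field.
  by rewrite exprMn expr2 -natrM ler_pM2l.
Qed.

Lemma conc_lik_max A : sym_posdef A -> 0 < \det (scatter X A) ->
  conc_lik A (6 *: invmx (scatter X A)) * \det (scatter X A) ^+ 3 =
  max6 * \det A ^+ 3.
Proof.
move=> pA dC; have dC0 : \det (scatter X A) != 0 by rewrite gt_eqF.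
rewrite /conc_lik -scalemxAl mulVmx ?unitmxE ?unitfE// mxtraceZ mxtrace1.
rewrite detZ det_inv /max6 (_ : 2^-1 * _ = 6); last by field.
by field.
Qed.

(** A singular scatter matrix has a kernel direction along which [B] can grow without cost in the
    trace. *)
Lemma conc_lik_unbounded A L : sym_posdef A -> \det (scatter X A) = 0 ->
  exists2 B, sym_posdef B & L < conc_lik A B.
Proof.
move=> pA; set C := scatter X A => dC.
have pC : sym_psd C by exact/scatter_psd/sym_posdef_psd.
have sC := sym2 pC.1; have [C0 C1] := sym_psd2_diag pC.
have dA := det_posdef2_gt0 pA.
pose tau := C 0 0 + C 1 1; have tau0 : 0 <= tau by rewrite addr_ge0.
pose c := (\det A * 4) ^+ 3 * expR (- 1).
have c0 : 0 < c by rewrite mulr_gt0 ?expR_gt0 ?exprn_gt0 ?mulr_gt0.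
have [l Ll l0] : exists2 l : R, L <= l & 0 < l.
  by exists (Num.max L 1); rewrite ?le_max ?lexx// lt_max ltr01 orbT.
have [t tE t0] : exists2 t : R, (tau + 1) ^+ 3 = t & 0 < t.
  by exists ((tau + 1) ^+ 3); rewrite // exprn_gt0// ltr_wpDl.
(* Since e <= 1, (e (tau + e))^3 is at most e (tau + 1)^3 = e t, so a condition linear in e
   suffices. *)
have [e [e0 e1 ec]] : exists e : R, [/\ 0 < e, e <= 1 & e * (l * t) < c].
  have r0 : 0 < c / (2 * (l * t)) by rewrite divr_gt0// !mulr_gt0.
  exists (Num.min 1 (c / (2 * (l * t)))).
  rewrite lt_min ltr01 r0 ge_min lexx; split=> //.
  have lt0 : 0 < l * t by rewrite mulr_gt0.
  rewrite -ltr_pdivlMr// gt_min; apply/orP; right.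
  rewrite ltr_pM2l// ltf_pV2 ?posrE ?mulr_gt0// mulr_natl mulr2n ltrDl.
  exact: lt0.
have te : 0 < tau + e by rewrite ltr_wpDl.
(* A multiple of adj C + e I: its trace against C stays bounded while its
   determinant tends to infinity as e tends to 0. *)
exists ((2 / (e * (tau + e))) *: mx2 (C 1 1 + e) (- C 0 1) (- C 0 1) (C 0 0 + e)).
  apply: sym_posdef2Z; first by rewrite divr_gt0 ?mulr_gt0.
  apply/sym_posdef2P; rewrite !mx2E; split=> //; first by rewrite ltr_wpDl.
  rewrite det2E !mx2E (_ : _ - _ = \det C + e * (tau + e)); last first.
    by rewrite det2E sC /tau; ring.
  by rewrite dC add0r mulr_gt0.
set B := _ *: _.
have dB : \det B = 4 / (e * (tau + e)).
  rewrite detZ det2E !mx2E (_ : _ - _ = \det C + e * (tau + e)); last first.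
    by rewrite det2E sC /tau; ring.
  by rewrite dC add0r; field; rewrite !gt_eqF.
have tB : 2^-1 * \tr (B *m C) = tau / (tau + e).
  rewrite -scalemxAl mxtraceZ trace_mulmx2 !mx2E sC.
  rewrite [X in _ * (_ * X)](_ : _ = 2 * \det C + e * tau); last first.
    by rewrite det2E sC /tau; ring.
  by rewrite dC; field; rewrite !gt_eqF.
have tB1 : 2^-1 * \tr (B *m C) <= 1.
  by rewrite tB ler_pdivrMr// mul1r lerDl ltW.
apply: (le_lt_trans Ll).
apply: (@lt_le_trans _ _ ((\det A * \det B) ^+ 3 * expR (- 1))); last first.
  rewrite /conc_lik -/C ler_pM2l ?ler_expR ?lerN2// exprn_gt0// mulr_gt0//.
  by rewrite dB divr_gt0 ?mulr_gt0.
have -> : (\det A * \det B) ^+ 3 * expR (- 1) = c / (e * (tau + e)) ^+ 3.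
  by rewrite dB /c; field; rewrite !gt_eqF.
rewrite ltr_pdivlMr ?exprn_gt0 ?mulr_gt0//.
apply: le_lt_trans ec; rewrite [leRHS]mulrCA ler_pM2l// exprMn -tE.
apply: ler_pM.
- exact/exprn_ge0/ltW.
- exact/exprn_ge0/ltW.
- by rewrite exprS ler_piMr ?exprn_ile1 ?(ltW e0).
- by apply: lerXn2r; rewrite ?nnegrE ?(ltW te) ?lerD2l// addr_ge0.
Qed.

End concentrated_likelihood.

(** * Characterisation of non-uniqueness *)

Section not_unique.
Variables (R : realType) (X : 'I_3 -> 'M[R]_2).
Implicit Types A B : 'M[R]_2.

Let k0 := kform0 X.
Let k1 := kform1 X.
Let k2 := kform2 X.

(** [kform X A] is tr (K A) for the symmetric K with diagonal k0, k2 and off-diagonal entry k1 / 2.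
    A nonpositive discriminant makes K semidefinite up to sign, and such a K pairs to zero with a
    definite [A] only if K = 0. *)
Lemma kform_eq0 A : sym_posdef A -> kform X A = 0 ->
  4 * (k0 * k2) < k1 ^+ 2 \/ [/\ k0 = 0, k1 = 0 & k2 = 0].
Proof.
move=> /sym_posdef2P[sA A0 dA]; rewrite /kform -/k0 -/k1 -/k2 => kA.
have [disc|disc] := ltP (4 * (k0 * k2)) (k1 ^+ 2); [by left|right].
(* The left side is 4 k0 [A 0 0] times [kform X A]; each of its three summands is nonnegative. *)
have sum0 : (2 * k0 * A 0 0 + k1 * A 0 1) ^+ 2 +
    (4 * (k0 * k2) - k1 ^+ 2) * A 0 1 ^+ 2 + 4 * (k0 * k2) * \det A = 0.
  transitivity (4 * k0 * A 0 0 * (k0 * A 0 0 + k1 * A 0 1 + k2 * A 1 1)).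
    by rewrite det2E sA; ring.
  by rewrite kA mulr0.
have k02 : 0 <= 4 * (k0 * k2) by apply: le_trans disc; rewrite sqr_ge0.
have ge1 : 0 <= (4 * (k0 * k2) - k1 ^+ 2) * A 0 1 ^+ 2.
  by rewrite mulr_ge0 ?sqr_ge0// subr_ge0.
have ge2 : 0 <= 4 * (k0 * k2) * \det A by rewrite mulr_ge0// ltW.
have ge0 := sqr_ge0 (2 * k0 * A 0 0 + k1 * A 0 1).
have /eqP : 4 * (k0 * k2) * \det A = 0 by lra.
rewrite mulf_eq0 (gt_eqF dA) orbF => /eqP k020.
have k10 : k1 = 0.
  by apply/eqP; rewrite -sqrf_eq0 eq_le sqr_ge0 andbT -k020.
have /eqP : 2 * k0 * A 0 0 + k1 * A 0 1 = 0.
  by apply/eqP; rewrite -sqrf_eq0; apply/eqP; lra.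
rewrite k10 mul0r addr0 !mulf_eq0 pnatr_eq0 (gt_eqF A0) orbF /= => /eqP k00.
have A1 : A 1 1 != 0.
  apply: contraTneq dA => A1.
  by rewrite det2E A1 mulr0 sub0r sA -expr2 oppr_gt0 -leNgt sqr_ge0.
move/eqP: kA; rewrite k10 k00 !mul0r !add0r mulf_eq0 (negPf A1) orbF.
by move=> /eqP.
Qed.

(** After normalising [A 0 0] to 1, definiteness is the region y^2 < z above a parabola and the
    kernel is the line k0 + k1 y + k2 z = 0. Two points of the line in this region are needed; their
    equal corner entries later rule out proportionality. *)
Lemma kform_kernel :
  4 * (k0 * k2) < k1 ^+ 2 \/ [/\ k0 = 0, k1 = 0 & k2 = 0] ->
  exists A1 A2, [/\ sym_posdef A1, sym_posdef A2, A1 <> A2, A1 0 0 = A2 0 0 &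
    kform X A1 = 0 /\ kform X A2 = 0].
Proof.
move=> H.
suff [y1 [z1 [y2 [z2 [pd1 pd2 e1 e2 ne]]]]] : exists y1 z1 y2 z2, [/\ y1 ^+ 2 < z1,
    y2 ^+ 2 < z2, k0 + k1 * y1 + k2 * z1 = 0, k0 + k1 * y2 + k2 * z2 = 0 &
    (y1, z1) <> (y2, z2)].
  have pd y z : y ^+ 2 < z -> sym_posdef (mx2 1 y y z).
    move=> yz; apply/sym_posdef2P; rewrite det2E !mx2E; split=> //.
    by rewrite mul1r subr_gt0 -expr2.
  exists (mx2 1 y1 y1 z1), (mx2 1 y2 y2 z2).
  rewrite /kform -/k0 -/k1 -/k2 !mx2E !mulr1; split=> //; try exact: pd.
  move=> /matrixP eM; apply: ne.
  by have := eM 0 1; have := eM 1 1; rewrite !mx2E => -> ->.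
have [k20|k20] := eqVneq k2 0.
  (* The line is vertical. If also k1 = 0, then k vanishes identically and the default value y = 0
     serves. *)
  pose y := - k0 / k1.
  have ky : k0 + k1 * y = 0.
    rewrite /y; have [k10|k10] := eqVneq k1 0; last by field.
    case: H => [|[-> _ _]]; last by rewrite oppr0 mul0r mulr0 addr0.
    by rewrite k20 k10 !mulr0 expr0n ltxx.
  exists y, (y ^+ 2 + 1), y, (y ^+ 2 + 2).
  rewrite !ltrDl ky k20 !mul0r addr0; split=> // -[] /addrI h.
  lra.
case: H => [disc|[_ _ /eqP]]; last by rewrite (negPf k20).
(* D is the largest height of the line above the parabola, reached at [y1]; the second abscissa
   [y1 + e] stays inside because e^2 < D. *)
pose D := (k1 ^+ 2 - 4 * (k0 * k2)) / (4 * k2 ^+ 2).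
have k22 : 0 < k2 ^+ 2 by rewrite exprn_even_gt0.
have D0 : 0 < D by rewrite divr_gt0 ?subr_gt0// mulr_gt0.
pose e := D / (1 + D).
have D1 : 0 < 1 + D by rewrite addr_gt0.
have e0 : e != 0 by rewrite mulf_neq0// ?invr_eq0 gt_eqF.
pose y1 := - k1 / (2 * k2).
pose z y := - (k0 + k1 * y) / k2.
have zE y : z y = y ^+ 2 + (D - (y - y1) ^+ 2).
  by rewrite /z /D /y1; field.
have kz y : k0 + k1 * y + k2 * z y = 0 by rewrite /z; field.
exists y1, (z y1), (y1 + e), (z (y1 + e)).
rewrite !kz !zE subrr expr0n /= subr0 !ltrDl; split=> //.
- rewrite addrAC subrr add0r subr_gt0 /e expr_div_n ltr_pdivrMr ?exprn_gt0//.
  by rewrite expr2 ltr_pM2l// expr2; nra.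
- by case=> /eqP; rewrite -subr_eq0 opprD addrA subrr sub0r oppr_eq0 (negPf e0).
Qed.

(** Minimality of k^2 / det at [A], cross-multiplied; by [det_scatter3] it amounts to minimality of
    det C(A) / det A. *)
Let kmin A := forall A', sym_posdef A' ->
  \det A' * kform X A ^+ 2 <= \det A * kform X A' ^+ 2.

(* If A1 and A2 were not proportional, |k(A2)| A1 + |k(A1)| A2 would do strictly
   better, by the reverse Cauchy-Schwarz inequality for the Lorentzian form det. *)
Lemma kform_min_unique A1 A2 : sym_posdef A1 -> sym_posdef A2 ->
  kmin A1 -> kmin A2 -> kform X A1 != 0 -> exists c, A2 = c *: A1.
Proof.
move=> pA1 pA2 min1 min2 kA1; have le21 := min1 _ pA2; have le12 := min2 _ pA1.
have d1 := det_posdef2_gt0 pA1; have d2 := det_posdef2_gt0 pA2.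
pose a : R := `|kform X A1|; pose b : R := `|kform X A2|.
have a2 : kform X A1 ^+ 2 = a ^+ 2 by rewrite /a real_normK// num_real.
have b2 : kform X A2 ^+ 2 = b ^+ 2 by rewrite /b real_normK// num_real.
have eq12 : \det A2 * a ^+ 2 = \det A1 * b ^+ 2.
  by apply/eqP; rewrite eq_le -a2 -b2 le21.
have a0 : 0 < a by rewrite normr_gt0.
have b0 : 0 < b.
  rewrite normr_gt0; apply: contraTneq (mulr_gt0 d2 (exprn_gt0 2 a0)) => kA2.
  by rewrite eq12 -b2 kA2 expr0n mulr0 ltxx.
have pA : sym_posdef (b *: A1 + a *: A2).
  have [[_ pb] [sa pa]] := (sym_posdef2Z b0 pA1, sym_posdef2Z a0 pA2).
  split; first by rewrite linearD /= sa (sym_posdef2Z b0 pA1).1.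
  by move=> v v0; rewrite mulmxDr mulmxDl mxE addr_gt0 ?pb ?pa.
pose tau := \tr (invmx A1 *m A2).
have tau0 : 0 <= tau.
  by apply/trace_posdef_psd_ge0/sym_posdef_psd => //; exact: sym_posdef2_inv.
have detE : \det (b *: A1 + a *: A2) =
    b ^+ 2 * \det A1 + a ^+ 2 * \det A2 + a * b * (\det A1 * tau).
  have d10 : A1 0 0 * A1 1 1 - A1 0 1 * A1 1 0 != 0 by rewrite -det2E gt_eqF.
  rewrite /tau invmx2E ?gt_eqF// trace_mulmx2 !det2E !mxE /=.
  by field.
have le_k : kform X (b *: A1 + a *: A2) ^+ 2 <= (2 * (a * b)) ^+ 2.
  have le_ab : `|b * kform X A1 + a * kform X A2| <= 2 * (a * b).
    apply: le_trans (ler_normD _ _) _; rewrite !normrM !normr_id -/a -/b.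
    by rewrite mulr_natl mulr2n [b * a]mulrC.
  rewrite kformD !kformZ -[leLHS]real_normK ?num_real//.
  by apply: lerXn2r; rewrite ?nnegrE// !mulr_ge0// ltW.
(* Minimality of [A1] against the combination bounds the polar form of det from above; AM-GM bounds
   it from below, so the equality case applies. *)
have le_tau : a * tau <= 2 * b.
  have := min1 _ pA; rewrite detE [a ^+ 2 * _]mulrC eq12 a2.
  move=> /le_trans/(_ (ler_wpM2l (ltW d1) le_k)).
  have -> : (b ^+ 2 * \det A1 + \det A1 * b ^+ 2 + a * b * (\det A1 * tau)) * a ^+ 2
     = (\det A1 * a ^+ 2 * b) * (2 * b + a * tau) by ring.
  have -> : \det A1 * (2 * (a * b)) ^+ 2 = (\det A1 * a ^+ 2 * b) * (4 * b) by ring.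
  by rewrite ler_pM2l ?mulr_gt0 ?exprn_gt0//; lra.
exists (tau / 2); rewrite -[A1 in RHS]invmxK.
apply: det_trace_sqr_eq; [exact: sym_posdef2_inv|exact: pA2.1|].
rewrite det_inv -/tau mulrA mulrAC ler_pdivlMr//.
rewrite -(ler_pM2r (exprn_gt0 2 a0)) -[leRHS]mulrA eq12.
have -> : tau ^+ 2 * \det A1 * a ^+ 2 = \det A1 * (a * tau) ^+ 2 by ring.
have -> : 4 * (\det A1 * b ^+ 2) = \det A1 * (2 * b) ^+ 2 by ring.
rewrite ler_pM2l//; apply: lerXn2r; rewrite ?nnegrE//.
- by rewrite mulr_ge0// ltW.
- by rewrite mulr_ge0// ltW.
Qed.

Lemma det_scatter_gt0 A : sym_posdef A -> kform X A = 0 ->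
  (0 < \det (scatter X A)) = (0 < scatter_gap X).
Proof.
move=> /sym_posdef2P[sA _ dA] kA.
by rewrite det_scatter3// kA expr0n mul0r addr0 pmulr_lgt0.
Qed.

Lemma mle_not_uniqueP : mle_not_unique X <->
  0 < scatter_gap X /\
  (4 * (k0 * k2) < k1 ^+ 2 \/ [/\ k0 = 0, k1 = 0 & k2 = 0]).
Proof.
split.
  move=> [K1 [K2 [/is_mle_conc[A1 [B1 [pA1 pB1 -> max1]]]]]].
  move=> /is_mle_conc[A2 [B2 [pA2 pB2 -> max2]]] K12.
  have det_gt0 A : sym_posdef A -> 0 < \det (scatter X A).
    move=> pA; rewrite lt_def det_scatter_ge0// andbT; apply/eqP => dC0.
    have [B pB] := conc_lik_unbounded (conc_lik X A1 B1) pA dC0.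
    by rewrite ltNge max1.
  have opt A B : sym_posdef A -> sym_posdef B ->
      (forall A' B', sym_posdef A' -> sym_posdef B' ->
        conc_lik X A' B' <= conc_lik X A B) ->
      scatter X A = 6 *: invmx B /\ kmin A.
    move=> pA pB max.
    (* The maximum dominates the value at [A'] paired with its own best partner
       [6 *: invmx (scatter X A')]. *)
    have ineq A' : sym_posdef A' -> 6 ^+ 6 * expR (- 6) * \det A' ^+ 3 <=
        conc_lik X A B * \det (scatter X A') ^+ 3.
      move=> pA'; have dC' := det_gt0 _ pA'.
      rewrite -(conc_lik_max pA' dC') ler_pM2r ?exprn_gt0//; apply: max => //.
      apply/sym_posdef2Z/sym_posdef2_inv => //.
      exact/sym_psd2_posdef/dC'/scatter_psd/sym_posdef_psd.
    split; first by apply: conc_lik_eq => //; exact: ineq.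
    move=> A' pA'.
    have dA := det_posdef2_gt0 pA; have dA' := det_posdef2_gt0 pA'.
    have dC := det_gt0 _ pA; have dC' := det_gt0 _ pA'.
    have : \det A' * \det (scatter X A) <= \det A * \det (scatter X A').
      rewrite -(@ler_pXn2r _ 3) ?nnegrE ?mulr_ge0 ?(ltW dA) ?(ltW dA')
        ?(ltW dC) ?(ltW dC')//.
      rewrite !exprMn -(ler_pM2l (_ : 0 < 6 ^+ 6 * expR (- 6) :> R)); last first.
        by rewrite mulr_gt0 ?exprn_gt0 ?expR_gt0.
      rewrite [leLHS]mulrA [leRHS]mulrA.
      apply: le_trans (ler_wpM2r (exprn_ge0 3 (ltW dC)) (ineq _ pA')) _.
      rewrite mulrAC; apply: ler_wpM2r; first exact/exprn_ge0/ltW.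
      exact: conc_lik_le.
    have /sym_posdef2P[sA _ _] := pA; have /sym_posdef2P[sA' _ _] := pA'.
    rewrite !det_scatter3// !mulrDr [\det A * (_ * _)]mulrCA.
    rewrite [\det A' * (_ * _)]mulrCA [\det A' * \det A]mulrC lerD2l !mulrA.
    by rewrite ler_pM2r// invr_gt0.
  have [C1 min1] := opt _ _ pA1 pB1 max1; have [C2 min2] := opt _ _ pA2 pB2 max2.
  have [kA1|kA1] := eqVneq (kform X A1) 0.
    split; last exact: kform_eq0 kA1.
    by rewrite -(det_scatter_gt0 pA1 kA1) det_gt0.
  have [c A12] := kform_min_unique pA1 pA2 min1 min2 kA1.
  have dA1 := det_posdef2_gt0 pA1.
  have c0 : c != 0.
    apply: contraTneq (det_posdef2_gt0 pA2) => c0.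
    by rewrite A12 c0 scale0r det2E !mxE mulr0 subr0 ltxx.
  have six0 : 6 != 0 :> R by rewrite pnatr_eq0.
  (* Replacing [A1] by [c *: A1] scales the scatter matrix by c and the inverse by 1 / c, so the
     Kronecker product does not change. *)
  case: K12; apply: (scalerI six0).
  have tensZl (a : R) (M N : 'M[R]_2) : a *: (M *t N) = (a *: M) *t N.
    by apply/matrixP => i j; rewrite !mxE mulrA.
  have tensZr (a : R) (M N : 'M[R]_2) : a *: (M *t N) = M *t (a *: N).
    by apply/matrixP => i j; rewrite !mxE mulrCA.
  rewrite !tensZl -C1 -C2 A12 scatterZ (invmx2Z c0 (lt0r_neq0 dA1)).
  rewrite -tensZl -tensZr scalerA.
  by rewrite mulfV// scale1r.
move=> [gap0 /kform_kernel[A1 [A2 [pA1 pA2 A12 A120 [kA1 kA2]]]]].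
pose K A := (6^-1 *: scatter X A) *t invmx A.
have six0 : 6^-1 != 0 :> R by rewrite invr_eq0 pnatr_eq0.
have pC A : sym_posdef A -> kform X A = 0 -> sym_posdef (scatter X A).
  move=> pA kA; apply: sym_psd2_posdef; last by rewrite det_scatter_gt0.
  exact/scatter_psd/sym_posdef_psd.
have mleK A : sym_posdef A -> kform X A = 0 -> is_mle X (K A).
  move=> pA kA; apply/is_mle_conc; have pCA := pC _ pA kA.
  have dC := det_posdef2_gt0 pCA; have dA := det_posdef2_gt0 pA.
  exists A, (6 *: invmx (scatter X A)); split=> //.
  - exact/sym_posdef2Z/sym_posdef2_inv.
  - rewrite invmx2Z ?pnatr_eq0 ?invmxK//.
    by rewrite det_inv invr_eq0 gt_eqF.
  move=> A' B' pA' pB'; have /sym_posdef2P[sA _ _] := pA.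
  have /sym_posdef2P[sA' _ dA'] := pA'.
  (* The gap is the least possible value of det C(A') / det A', attained where k vanishes. *)
  have gap_le : scatter_gap X * \det A' <= \det (scatter X A').
    by rewrite det_scatter3// lerDl divr_ge0 ?sqr_ge0.
  have dC' : 0 < \det (scatter X A') by apply: lt_le_trans gap_le; rewrite mulr_gt0.
  rewrite -(ler_pM2r (exprn_gt0 3 dC)) conc_lik_max//.
  rewrite det_scatter3// kA expr0n mul0r addr0 exprMn mulrA ler_pM2r ?exprn_gt0//.
  rewrite -(ler_pM2r (exprn_gt0 3 dA')).
  apply: le_trans (conc_lik_le X pA' pB'); rewrite -mulrA -exprMn.
  apply: ler_wpM2l.
    rewrite /conc_lik mulr_ge0 ?expR_ge0// exprn_ge0// mulr_ge0 ?(ltW dA')//.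
    exact/ltW/det_posdef2_gt0.
  apply: lerXn2r; rewrite ?nnegrE ?(ltW dC')//.
  by rewrite mulr_ge0// ltW.
exists (K A1), (K A2); split; [exact: mleK|exact: mleK|move=> K12; apply: A12].
have /sym_posdef2P[_ C1 _] := pC _ pA1 kA1.
have /sym_posdef2P[_ C2 _] := pC _ pA2 kA2.
(* Equality of the top left blocks of the two Kronecker products. *)
have inv12 : scatter X A1 0 0 *: invmx A1 = scatter X A2 0 0 *: invmx A2.
  apply/matrixP => i j; move/matrixP: K12.
  move=> /(_ (mxtens_index (0, i)) (mxtens_index (0, j))).
  rewrite !tensmxE !mxE -!mulrA => /(mulfI six0).
  by [].
have dA1 := det_posdef2_gt0 pA1; have dA2 := det_posdef2_gt0 pA2.
have /(congr1 invmx) := inv12; rewrite !invmx2Z ?gt_eqF ?det_inv ?invr_gt0// !invmxK.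
move=> AA; have := congr1 (fun M : 'M[R]_2 => M 0 0) AA; rewrite !mxE A120.
have /sym_posdef2P[_ A20 _] := pA2.
move=> /(mulIf (lt0r_neq0 A20))/invr_inj c12.
by move: AA; rewrite c12; apply: scalerI; rewrite invr_eq0 gt_eqF.
Qed.

End not_unique.

(** * Boxes under a normal law *)

(* [ge0_le_integral] asks for measurability, which is not available for the
   inner integrals of an iterated integral. *)
Lemma ge0_le_integralT d (T : measurableType d) (R : realType)
    (mu : {measure set T -> \bar R}) (f g : T -> \bar R) :
  (forall x, 0 <= f x)%E -> (forall x, f x <= g x)%E ->
  (\int[mu]_x f x <= \int[mu]_x g x)%E.
Proof.
move=> f0 fg; rewrite !ge0_integralTE//; last first.
  by move=> x; exact: le_trans (fg x).
apply: ge_ereal_sup => _ [h hf <-]; apply: ereal_sup_ubound; exists h => // x.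
exact: le_trans (fg x).
Qed.

Section measurable_matrix.
Variable R : realType.

Lemma measurable_coord m n (i : 'I_m) (j : 'I_n) :
  measurable_fun setT (fun M : 'M[R]_(m, n) => M i j).
Proof.
apply: (measurability _ (RGenOpens.measurableE R)).
move=> _ [_ [a [b ->] <-]]; rewrite setTI; apply: sub_sigma_algebra.
have /continuousP := @coord_continuous R m n i j; apply.
exact: interval_open.
Qed.

Definition mx_box m n (c : 'M[R]_(m, n)) (r : R) : set 'M[R]_(m, n) :=
  [set M | forall i j, `|M i j - c i j| < r].

Lemma measurable_mx_box m n (c : 'M[R]_(m, n)) r : measurable (mx_box c r).
Proof.
have -> : mx_box c r = \bigcap_(p in [set: 'I_m * 'I_n])
    ((fun M : 'M[R]_(m, n) => M p.1 p.2) @^-1` `]c p.1 p.2 - r, c p.1 p.2 + r[).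
  apply/seteqP; split=> M.
    by move=> H [i j] _ /=; have := H i j; rewrite ltr_distl in_itv.
  by move=> H i j; have := H (i, j) I; rewrite /= ltr_distl in_itv.
apply: fin_bigcap_measurable; first exact: finite_finset.
move=> p _; rewrite -[X in measurable X]setTI.
by apply: measurable_coord => //; exact: measurable_itv.
Qed.

End measurable_matrix.

Section normal_box.
Variable R : realType.

Lemma lebesgue_integral_cV_ge0 m (f : 'cV[R]_m -> \bar R) :
  (forall v, 0 <= f v)%E -> (0 <= lebesgue_integral_cV f)%E.
Proof.
elim: m f => [|m IH] f f0 /=; first exact: f0.
by apply: integral_ge0 => x _; apply: IH => v; exact: f0.
Qed.

Lemma lebesgue_integral_cV0 (m : nat) :
  @lebesgue_integral_cV R m (fun=> 0%E) = 0%E.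
Proof.
by elim: m => [//|m IH] /=; under eq_integral do rewrite IH; rewrite integral0.
Qed.

(** Induction on the dimension: each outer integral is at least the one over an interval of length 2
    r, where the inner integral has a constant lower bound. *)
Lemma lebesgue_integral_cV_box m (f : 'cV[R]_m -> \bar R) c (r k : R) :
  0 <= r -> 0 <= k -> (forall v, 0 <= f v)%E ->
  (forall v, mx_box c r v -> k%:E <= f v)%E ->
  ((k * (2 * r) ^+ m)%:E <= lebesgue_integral_cV f)%E.
Proof.
move=> r0 k0; elim: m f c => [|m IH] f c f0 fk /=.
  by rewrite expr0 mulr1; apply: fk => -[].
pose x0 : R := c 0 0; pose D : set R := `]x0 - r, x0 + r[%classic.
pose k' : R := k * (2 * r) ^+ m.
have k'0 : 0 <= k' by rewrite mulr_ge0// exprn_ge0// mulr_ge0.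
apply: (@le_trans _ _ (\int[lebesgue_measure]_(x in D) cst k'%:E x)%E).
  rewrite integral_cst; last exact: measurable_itv.
  have mD : (lebesgue_measure D = (2 * r)%:E)%E.
    rewrite /D lebesgue_measure_itv /= lte_fin; case: ltP => [_|r00].
      by rewrite -EFinB; congr EFin; ring.
    have -> : r = 0 by apply/eqP; rewrite eq_le r0 andbT; lra.
    by rewrite mulr0.
  by rewrite [X in (_ * X)%E]mD -EFinM lee_fin exprSr mulrA.
rewrite integral_mkcond; apply: ge0_le_integralT => x; rewrite /patch.
  by case: ifP => // _; rewrite lee_fin.
case: ifPn => [|_]; last by apply: lebesgue_integral_cV_ge0 => v; exact: f0.
rewrite inE /D /= in_itv /= -ltr_distl => xx0.
apply: (IH _ (\col_i c (rshift 1 i) 0)) => [v|v vc]; first exact: f0.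
apply: fk => i j; rewrite (ord1 j).
rewrite -(@splitK 1 m i); case: (@fintype.split 1 m i) => i' /=.
  rewrite [X in X - _](_ : _ = x).
    by rewrite (ord1 i') (_ : lshift m 0 = 0)//; exact: val_inj.
  by rewrite [LHS](@col_mxEu _ 1 m) (ord1 i') mxE eqxx mulr1n.
rewrite [X in X - _](_ : _ = v i' 0); last exact: (@col_mxEd _ 1 m).
by have := vc i' 0; rewrite mxE.
Qed.

(** A crude bound, uniform in [v], which keeps the normal density away from zero on a box. *)
Lemma quad_form_box_le m (S : 'M[R]_m) (mu c v : 'cV[R]_m) r : mx_box c r v ->
  ((v - mu)^T *m S *m (v - mu)) 0 0 <=
  \sum_j (\sum_i (`|c i 0 - mu i 0| + r) * `|S i j|) * (`|c j 0 - mu j 0| + r).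
Proof.
move=> vc.
have le i : `|v i 0 - mu i 0| <= `|c i 0 - mu i 0| + r.
  rewrite -(subrK (c i 0) (v i 0)) -addrA addrC.
  apply: le_trans (ler_normD _ _) _; rewrite lerD2l; exact/ltW/vc.
rewrite mxE; apply: ler_sum => j _; apply: le_trans (ler_norm _) _.
rewrite normrM; apply: ler_pM => //; last by rewrite !mxE; exact: le.
rewrite mxE; apply: le_trans (ler_norm_sum _ _ _) _; apply: ler_sum => i _.
by rewrite normrM ler_wpM2r// !mxE; exact: le.
Qed.

Lemma mvnormal_box_gt0 d (Omega : measurableType d) (P : probability Omega R)
    m (Y : Omega -> 'cV[R]_m) (mu : 'cV[R]_m) (Sigma : 'M[R]_m) c r :
  has_mvnormal_law P Y mu Sigma -> 0 < r -> (0 < P (Y @^-1` mx_box c r))%E.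
Proof.
move=> law r0.
pose a : R := (Num.sqrt ((2 * pi) ^+ m * \det Sigma))^-1.
have a0 : 0 < a.
  (* A zero normalising constant would make the density vanish, and the total mass would be 0
     instead of 1. *)
  rewrite lt_def invr_ge0 sqrtr_ge0 andbT; apply/eqP => a0.
  have := law _ measurableT; rewrite preimage_setT probability_setT.
  have -> : (fun x => (mvnormal_pdf mu Sigma x * \1_setT x)%:E) = fun=> 0%E.
    by apply/funext => x; rewrite /mvnormal_pdf -/a a0 !mul0r.
  by rewrite lebesgue_integral_cV0 => /eqP; rewrite eqe oner_eq0.
rewrite (law _ (measurable_mx_box c r)).
pose b := \sum_j (\sum_i (`|c i 0 - mu i 0| + r) * `|invmx Sigma i j|) *
  (`|c j 0 - mu j 0| + r).
have pdf_ge0 x : 0 <= mvnormal_pdf mu Sigma x.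
  by rewrite /mvnormal_pdf -/a mulr_ge0 ?expR_ge0// ltW.
apply: (@lt_le_trans _ _ (a * expR (- b / 2) * (2 * r) ^+ m)%:E).
  by rewrite lte_fin !mulr_gt0 ?expR_gt0// exprn_gt0// mulr_gt0.
apply: (lebesgue_integral_cV_box (c := c)) => [||v|v vc].
- exact: ltW.
- by rewrite mulr_ge0 ?expR_ge0// ltW.
- by rewrite lee_fin mulr_ge0.
- rewrite lee_fin indicE mem_set// mulr1 /mvnormal_pdf -/a ler_pM2l//.
  by rewrite ler_expR ler_pM2r// lerN2; exact: quad_form_box_le.
Qed.

End normal_box.

(** * The event of non-uniqueness *)

Lemma mx_box_vec (R : realType) p q (c M : 'M[R]_(p, q)) r :
  mx_box (vec c) r (vec M) <-> mx_box c r M.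
Proof.
split=> [H i j|H i j]; last by rewrite !mxE; exact: H.
by have := H (mxtens_index (j, i)) 0; rewrite !vecE.
Qed.

Section measurability.
Variables (R : realType) (d : measure_display) (Omega : measurableType d).
Variable (X : 'I_3 -> Omega -> 'M[R]_2).
Hypothesis mX : forall k, measurable_fun setT (X k).

Let mXij k i j : measurable_fun setT (fun w => X k w i j).
Proof.
have := measurableT_comp (measurable_coord (R := R) i j) (mX k); exact.
Qed.

Let mP i j : measurable_fun setT (fun w => (X 0 w - X 1 w) i j).
Proof. by under eq_fun do rewrite !mxE; exact: measurable_funB. Qed.

Let mQ i j :
  measurable_fun setT (fun w => (X 0 w + X 1 w - 2 *: X (inord 2) w) i j).
Proof.
under eq_fun do rewrite !mxE.
by apply: measurable_funB; [exact: measurable_funD|exact: measurable_funM].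
Qed.

Let mM (f g : Omega -> R) : measurable_fun setT f -> measurable_fun setT g ->
  measurable_fun setT (fun w => f w * g w).
Proof. exact: measurable_funM. Qed.

Let mB (f g : Omega -> R) : measurable_fun setT f -> measurable_fun setT g ->
  measurable_fun setT (fun w => f w - g w).
Proof. exact: measurable_funB. Qed.

Let mD (f g : Omega -> R) : measurable_fun setT f -> measurable_fun setT g ->
  measurable_fun setT (fun w => f w + g w).
Proof. exact: measurable_funD. Qed.

Let mkform0 : measurable_fun setT (fun w => kform0 (X ^~ w)).
Proof. by apply: mB; apply: mM. Qed.

Let mkform1 : measurable_fun setT (fun w => kform1 (X ^~ w)).
Proof. by apply: mB; [apply: mD; [apply: mB|]|]; apply: mM. Qed.

Let mkform2 : measurable_fun setT (fun w => kform2 (X ^~ w)).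
Proof. by apply: mB; apply: mM. Qed.

Let mgap : measurable_fun setT (fun w => scatter_gap (X ^~ w)).
Proof.
rewrite /scatter_gap; under eq_fun do rewrite !det2E !expr2.
have c (x : R) : measurable_fun setT (fun _ : Omega => x) by [].
have mm : measurable_fun setT (fun w => mixed_det (X ^~ w)).
  by apply: mB; [apply: mB; [apply: mD|]|]; apply: mM.
apply: mD; last by apply: mM => //; exact: mM.
by apply: mM; apply: mB; apply: mM => //; apply: mB; apply: mM.
Qed.

Let measurable_gt0 (f : Omega -> R) :
  measurable_fun setT f -> measurable [set w | 0 < f w].
Proof.
move=> mf; have := mf measurableT _ (measurable_itv `]0, +oo[).
by rewrite setTI; congr measurable; apply/seteqP; split=> w /=; rewrite in_itv /= andbT.
Qed.

Let measurable_eq0 (f : Omega -> R) :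
  measurable_fun setT f -> measurable [set w | f w = 0].
Proof. by move=> mf; have := mf measurableT _ (measurable_set1 0); rewrite setTI. Qed.

(** The characterisation replaces the quantifiers over matrices by finitely many polynomial
    conditions on the entries. *)
Lemma measurable_mle_not_unique :
  measurable [set w | mle_not_unique (X ^~ w)].
Proof.
have -> : [set w | mle_not_unique (X ^~ w)] =
    [set w | 0 < scatter_gap (X ^~ w)] `&`
    ([set w | 0 < kform1 (X ^~ w) * kform1 (X ^~ w) -
      4 * (kform0 (X ^~ w) * kform2 (X ^~ w))] `|`
     ([set w | kform0 (X ^~ w) = 0] `&` [set w | kform1 (X ^~ w) = 0] `&`
      [set w | kform2 (X ^~ w) = 0])).
  apply/seteqP; split=> w /=; rewrite mle_not_uniqueP subr_gt0 -expr2.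
    by move=> [gap [lt|[k0 k1 k2]]]; split=> //; [left|right].
  by move=> [gap [lt|[[k0 k1] k2]]]; split=> //; [left|right].
apply: measurableI; first exact: measurable_gt0.
apply: measurableU.
  by apply: measurable_gt0; apply: mB; apply: mM => //; exact: mM.
by apply: measurableI; [apply: measurableI|]; exact: measurable_eq0.
Qed.

End measurability.

Section box_event.
Variable R : realType.

(** At the centres X 0 - X 1 is diag(10, -10) and X 0 + X 1 - 2 X 2 is diag(-10, -10). Radius 1
    moves their entries by less than 2 and 4, which preserves the signs of both determinants. *)
Definition box_center (k : 'I_3) : 'M[R]_2 :=
  if k == 0 then mx2 5 0 0 (- 5) else if k == 1 then mx2 (- 5) 0 0 5
  else mx2 5 0 0 5.

(* On this box det (X 0 - X 1) < 0 < det (X 0 + X 1 - 2 X 2), which makes the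
   discriminant of [kform] positive. *)
Lemma mle_not_unique_box (X : 'I_3 -> 'M[R]_2) :
  (forall k, mx_box (box_center k) 1 (X k)) -> mle_not_unique X.
Proof.
move=> XB; pose P := X 0 - X 1; pose Q := X 0 + X 1 - 2 *: X (inord 2).
have b0 i j := XB 0 i j; have b1 i j := XB 1 i j; have b2 i j := XB (inord 2) i j.
have ne20 : (inord 2 == 0 :> 'I_3) = false by rewrite -val_eqE /= inordK.
have ne21 : (inord 2 == 1 :> 'I_3) = false by rewrite -val_eqE /= inordK.
move: b0 b1 b2; rewrite /box_center ne20 ne21 /= => b0 b1 b2.
move: (b0 0 0) (b0 0 1) (b0 1 0) (b0 1 1) (b1 0 0) (b1 0 1) (b1 1 0) (b1 1 1)
  (b2 0 0) (b2 0 1) (b2 1 0) (b2 1 1); rewrite !mx2E !ltr_distl.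
move=> /andP[? ?] /andP[? ?] /andP[? ?] /andP[? ?] /andP[? ?] /andP[? ?]
  /andP[? ?] /andP[? ?] /andP[? ?] /andP[? ?] /andP[? ?] /andP[? ?].
have small (x y m : R) : - m < x < m -> - m < y < m -> - (m * m) < x * y < m * m.
  by move=> /andP[? ?] /andP[? ?]; apply/andP; split; nra.
have dP : \det P < 0.
  rewrite det2E; have : 8 < P 0 0 by rewrite !mxE; lra.
  have : P 1 1 < - 8 by rewrite !mxE; lra.
  have /andP[] : - (2 * 2) < P 0 1 * P 1 0 < 2 * 2.
    by apply: small; rewrite !mxE; apply/andP; split; lra.
  by move: (P 0 0) (P 1 1) (P 0 1 * P 1 0) => x y z; nra.
have dQ : 0 < \det Q.
  rewrite det2E; have : Q 0 0 < - 6 by rewrite !mxE; lra.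
  have : Q 1 1 < - 6 by rewrite !mxE; lra.
  have /andP[] : - (4 * 4) < Q 0 1 * Q 1 0 < 4 * 4.
    by apply: small; rewrite !mxE; apply/andP; split; lra.
  by move: (Q 0 0) (Q 1 1) (Q 0 1 * Q 1 0) => x y z; nra.
have dPQ : \det P * \det Q < 0 by rewrite nmulr_rlt0.
apply/mle_not_uniqueP; split.
  rewrite /scatter_gap -/P -/Q ltr_wpDr ?divr_ge0 ?sqr_ge0// exprn_even_gt0//=.
  by rewrite lt_eqF// subr_lt0; lra.
left; rewrite -subr_gt0 kform_disc -/P -/Q subr_gt0.
by apply: lt_le_trans (sqr_ge0 _); lra.
Qed.

End box_event.

Theorem mainTheorem3 (R : realType) (d : measure_display)
    (Omega : measurableType d) (P : probability Omega R)
    (mu : 'cV[R]_(2 * 2)) (Gamma Psi : 'M[R]_2)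
    (X : 'I_3 -> {RV P >-> 'M[R]_(2, 2)}) :
  sym_posdef Gamma -> sym_posdef Psi ->
  mutually_independent P (fun k => X k : Omega -> 'M[R]_(2, 2)) ->
  (forall k, has_mvnormal_law P (fun w => vec (X k w)) mu (Psi *t Gamma)) ->
  let E := [set w | mle_not_unique (fun k => X k w)] in
  measurable E /\ (0 < P E)%E.
Proof.
move=> _ _ indep law E.
have mE : measurable E.
  by apply: (measurable_mle_not_unique (X := fun k => X k)) => k.
split=> //.
pose B k := mx_box (box_center R k) 1.
have mB k : measurable (B k) by exact: measurable_mx_box.
pose F := \bigcap_(k in [set` [set: 'I_3]%SET]) X k @^-1` B k.
have mF : measurable F.
  apply: fin_bigcap_measurable => [|k _]; first exact: finite_finset.
  exact: measurable_funPTI.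
apply: (@lt_le_trans _ _ (P F)); last first.
  apply: le_measure; rewrite ?inE// => w Fw.
  by apply: mle_not_unique_box => k; apply: Fw; rewrite /= inE.
(* Independence turns the probability of the joint box event into a product of three positive
   factors. *)
rewrite /F indep//; apply: (big_ind (fun x => 0 < x)%E).
- exact: lte01.
- exact: mule_gt0.
(* The law concerns [vec (X k)], and [vec] matches the box around a matrix with the box around its
   vectorisation. *)
move=> k _; have := mvnormal_box_gt0 (vec (box_center R k)) (law k) ltr01.
by congr (0 < P _)%E; apply/seteqP; split=> w /= /mx_box_vec.
Qed.
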